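(* Let $q\geq 4$, let $\Gamma=H(q,q)$, let $C=C(A_q)\cup\mathrm{Rep}(q,q)$, and let $X=\mathrm{Diag}_q(S_q)\rtimes L\leq\mathrm{Aut}(\Gamma)$. Then $(C,X)$ is an elusive pair and $X$ is not transitive on $\Gamma_1(C)$. Moreover, for $q\geq 5$, $X$ is the setwise stabiliser in $\mathrm{Aut}(\Gamma)$ of $\Gamma_1(C)$.
   Context: Let $Q=\{1,\ldots,q\}$. $\Gamma=H(m,q)$ is the Hamming graph whose vertices are all $m$-tuples with entries in $Q$, two being adjacent if and only if they differ in exactly one position; the distance $d(\alpha,\beta)$ is the number of entries in which $\alpha,\beta$ differ. A code is a set $C$ of vertices; its minimum distance is $\delta=\min\{d(\alpha,\beta)\mid\alpha,\beta\in C,\alpha\neq\beta\}$; $\Gamma_1(C)$ is the set of vertices not in $C$ that are adjacent to at least one element of $C$. Elusive pair: if $C$ is a code in $\Gamma=H(m,q)$ with minimum distance $\delta$ and $X\leq\mathrm{Aut}(\Gamma)$ fixes $\Gamma_1(C)$ setwise but does not fix $C$ setwise, then $(C,X)$ is an elusive pair with parameters $(m,q,\delta)$. $\mathrm{Aut}(\Gamma)=N\rtimes L$ with $N\cong S_q^m$ and $L\cong S_m$, acting (on the right) by $\alpha^{g}=(\alpha_1^{g_1},\ldots,\alpha_m^{g_m})$ for $g=(g_1,\ldots,g_m)\in N$ and $\alpha^{\sigma}=(\alpha_{1^{\sigma^{-1}}},\ldots,\alpha_{m^{\sigma^{-1}}})$ for $\sigma\in L$. Here $m=q$. $\mathrm{Diag}_q(S_q)=\{(y,\ldots,y)\mid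 y\in S_q\}\leq N$. $S_q$ and $A_q$ are the symmetric and alternating groups on $Q$. For $g\in S_q$, $\alpha(g)=(1^g,\ldots,q^g)\in H(q,q)$, and for $T\subseteq S_q$, $C(T)=\{\alpha(g)\mid g\in T\}$. The repetition code is $\mathrm{Rep}(q,q)=\{(a,\ldots,a)\mid a\in Q\}\subseteq H(q,q)$. *)

(* Defs.v *)
From mathcomp Require Import all_boot all_fingroup all_solvable.

Set Implicit Arguments.
Unset Strict Implicit.
Unset Printing Implicit Defensive.

Import GroupScope.

(* The alphabet Q = {1, .., q} is 'I_q, and positions are 'I_m. *)
Notation hvertex m q := {ffun 'I_m -> 'I_q}.

Section Hamming.

Variables m q : nat.
Implicit Types (a b : hvertex m q) (C : {set hvertex m q}).

Definition hdist a b : nat := #|[set i | a i != b i]|.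

Definition hadj : rel (hvertex m q) := fun a b => hdist a b == 1%N.

Definition min_dist C (delta : nat) : Prop :=
  (exists a b, [/\ a \in C, b \in C, a != b & hdist a b = delta])
  /\ (forall a b, a \in C -> b \in C -> a != b -> delta <= hdist a b).

(* The set Gamma_1(C). *)
Definition code_nbrs C : {set hvertex m q} :=
  [set b | (b \notin C) && [exists a in C, hadj a b]].

Definition hamming_aut : {set {perm hvertex m q}} :=
  [set s : {perm hvertex m q} | [forall a, forall b, hadj (s a) (s b) == hadj a b]].

Lemma hamming_aut_group_set : group_set hamming_aut.
Proof.
apply/group_setP; split=> [|s t].
  by rewrite inE; apply/forallP=> a; apply/forallP=> b; rewrite !perm1.
rewrite !inE => /forallP Hs /forallP Ht.
apply/forallP=> a; apply/forallP=> b; rewrite !permM.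
by rewrite (eqP (forallP (Ht _) _)) (eqP (forallP (Hs _) _)).
Qed.

Canonical hamming_aut_group := Group hamming_aut_group_set.

(* 'P is the natural action of permutations, so [acts X, on S | 'P] says that
   X fixes S setwise. *)
Definition elusive_pair (delta : nat) C (X : {group {perm hvertex m q}}) : Prop :=
  [/\ min_dist C delta,
      X \subset hamming_aut,
      [acts X, on code_nbrs C | 'P]
    & ~~ [acts X, on C | 'P]].

Definition base_act (g : {ffun 'I_m -> 'S_q}) a : hvertex m q :=
  [ffun i => g i (a i)].

Lemma base_act_inj g : injective (base_act g).
Proof.
move=> a b /ffunP eq_ab; apply/ffunP=> i.
by have := eq_ab i; rewrite !ffunE => /perm_inj.
Qed.

Definition base_perm g : {perm hvertex m q} := perm (@base_act_inj g).

Definition top_act (s : 'S_m) a : hvertex m q := [ffun i => a (s^-1 i)].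

Lemma top_act_inj s : injective (top_act s).
Proof.
move=> a b /ffunP eq_ab; apply/ffunP=> i.
by have := eq_ab (s i); rewrite !ffunE permK.
Qed.

Definition top_perm s : {perm hvertex m q} := perm (@top_act_inj s).

(* The complement L, isomorphic to S_m. *)
Definition top : {set {perm hvertex m q}} := [set top_perm s | s : 'S_m].

(* Diag_m(S_q), inside N = [set base_perm g | g]. *)
Definition diag : {set {perm hvertex m q}} :=
  [set base_perm [ffun => y] | y : 'S_q].

Lemma top_permM s t : top_perm (s * t) = top_perm s * top_perm t.
Proof.
apply/permP=> a; rewrite permM !permE; apply/ffunP=> i.
by rewrite !ffunE invMg permM.
Qed.

Lemma diag_permM (y z : 'S_q) :
  base_perm [ffun => y * z] = base_perm [ffun => y] * base_perm [ffun => z].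
Proof.
apply/permP=> a; rewrite permM !permE; apply/ffunP=> i.
by rewrite !ffunE permM.
Qed.

Lemma top_perm1 : top_perm 1 = 1.
Proof. by apply: (mulgI (top_perm 1)); rewrite -top_permM !mulg1. Qed.

Lemma diag_perm1 : base_perm [ffun => 1] = 1.
Proof. by apply: (mulgI (base_perm [ffun => 1])); rewrite -diag_permM !mulg1. Qed.

Lemma top_group_set : group_set top.
Proof.
apply/group_setP; split=> [|_ _ /imsetP[s _ ->] /imsetP[t _ ->]].
  by rewrite -top_perm1; apply: imset_f.
by rewrite -top_permM; apply: imset_f.
Qed.

Canonical top_group := Group top_group_set.

Lemma diag_group_set : group_set diag.
Proof.
apply/group_setP; split=> [|_ _ /imsetP[y _ ->] /imsetP[z _ ->]].
  by rewrite -diag_perm1; apply: imset_f.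
by rewrite -diag_permM; apply: imset_f.
Qed.

Canonical diag_group := Group diag_group_set.

Lemma diag_cent_top : top \subset 'C(diag).
Proof.
apply/centsP=> _ /imsetP[s _ ->] _ /imsetP[y _ ->].
apply/permP=> a; rewrite !permM !permE; apply/ffunP=> i.
by rewrite !ffunE.
Qed.

(* ><| is set0 when the product is not a semidirect one, so this shows that
   diag ><| top = X is satisfiable. *)
Lemma diag_top_sdprod : diag ><| top = diag <*> top.
Proof.
rewrite sdprodEY ?(subset_trans diag_cent_top) ?cent_sub //.
apply/trivgP/subsetP=> x /setIP[/imsetP[y _ ->] /imsetP[s _ eq_ys]].
apply/set1P/permP=> a; rewrite perm1 permE; apply/ffunP=> i.
have /permP/(_ [ffun => a i]) := eq_ys; rewrite !permE => /ffunP/(_ i).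
by rewrite !ffunE.
Qed.

End Hamming.

Arguments top m q : clear implicits.
Arguments hamming_aut m q : clear implicits.
Arguments diag m q : clear implicits.

Definition perm_vertex q (g : 'S_q) : hvertex q q := [ffun i => g i].

Definition perm_code q (T : {set 'S_q}) : {set hvertex q q} :=
  [set perm_vertex g | g in T].

Definition rep_code m q : {set hvertex m q} :=
  [set [ffun => x] | x : 'I_q].

(* Main.v *)
Require Import Defs.
From mathcomp Require Import all_boot all_fingroup all_solvable.
From mathcomp Require Import zify.

Set Implicit Arguments.
Unset Strict Implicit.
Unset Printing Implicit Defensive.

Import GroupScope.

(** The neighbours of [C] are the words with exactly [q - 1] distinct entries
    (each is adjacent to two permutations differing by a transposition, so to
    exactly one even permutation) together with the words differing from a
    constant word in one entry.  Both families are invariant under [X], which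
    moves even permutations to odd ones.  Conversely, for [q >= 5] the words
    all of whose neighbours lie in [Gamma_1(C)] are the constant words and all
    the permutations; among these the constant words are those at distance 2
    from no other.  So the stabiliser preserves the repetition code; modulo
    the diagonal group it fixes that code pointwise, and an automorphism fixing
    the constant words pointwise permutes the coordinates, since the entry of
    [w] in position [i] can be read off from the distances between [w] and the
    words adjacent to a constant word. *)

(** * Distances, automorphisms and constant words in a general Hamming graph *)

Section HammingGraph.

Variables m q : nat.
Implicit Types (a b v w : hvertex m q) (s t : {perm hvertex m q}).

Definition upd v (i : 'I_m) (x : 'I_q) : hvertex m q :=
  [ffun k => if k == i then x else v k].

Definition cst (x : 'I_q) : hvertex m q := [ffun=> x].

(** Its cardinality is the invariant that separates the two families of neighbours. *)
Definition im v : {set 'I_q} := [set v i | i : 'I_m].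

Lemma mem_im v i : v i \in im v.
Proof. by apply/imsetP; exists i. Qed.

Lemma hdistE a b : hdist a b = (\sum_i (a i != b i))%N.
Proof.
by rewrite /hdist -sum1dep_card big_mkcond; apply: eq_bigr => i _; case: (_ != _).
Qed.

Lemma hdistC a b : hdist a b = hdist b a.
Proof. by rewrite !hdistE; apply: eq_bigr => i _; rewrite eq_sym. Qed.

Lemma hdist_eq0 a b : (hdist a b == 0%N) = (a == b).
Proof.
apply/idP/eqP => [|->]; last by rewrite hdistE big1 // => i _; rewrite eqxx.
rewrite cards_eq0 => /eqP d0; apply/ffunP => i.
by have := in_set0 i; rewrite -d0 inE => /negbFE/eqP.
Qed.

Lemma hdistxx a : hdist a a = 0%N.
Proof. by apply/eqP; rewrite hdist_eq0. Qed.

(** Only the summand at [i] changes; the additive form avoids truncated subtraction. *)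
Lemma hdist_upd w v i x :
  (hdist w (upd v i x) + (w i != v i) = hdist w v + (w i != x))%N.
Proof.
rewrite !hdistE (bigD1 i) //= [in RHS](bigD1 i) //= ffunE eqxx.
under eq_bigr => k /negPf ki do rewrite ffunE ki.
by rewrite addnAC [RHS]addnAC; congr addn; apply: addnC.
Qed.

Lemma hadj_sym a b : hadj a b = hadj b a.
Proof. by rewrite /hadj hdistC. Qed.

Lemma hadj_upd v i x : x != v i -> hadj v (upd v i x).
Proof.
move=> xv; have := hdist_upd v v i x.
by rewrite hdistxx eqxx eq_sym xv /= addn0 => /eqP.
Qed.

Lemma hadjP v w :
  reflect (exists i x, x != v i /\ w = upd v i x) (hadj v w).
Proof.
apply: (iffP idP) => [|[i [x [xv ->]]]]; last exact: hadj_upd.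
move=> /cards1P[i Ei]; exists i, (w i).
have diffE k : (v k != w k) = (k == i) by rewrite -in_set1 -Ei inE.
split; first by rewrite eq_sym diffE.
apply/ffunP => k; rewrite ffunE; case: eqVneq => [->//|ki].
by apply/esym/eqP; rewrite -[_ == _]negbK diffE.
Qed.

Lemma hdist_hadj a b c : hadj b c -> (hdist a c <= (hdist a b).+1)%N.
Proof.
move=> /hadjP[i [x [_ ->]]]; have := hdist_upd a b i x.
by case: (_ != _); case: (_ != _) => /=; lia.
Qed.

Lemma hadj_aut s a b : s \in hamming_aut m q -> hadj (s a) (s b) = hadj a b.
Proof. by rewrite inE => /forallP/(_ a)/forallP/(_ b)/eqP. Qed.

(** Following a shortest path shows that an automorphism does not increase distances; the same bound
    for its inverse gives equality. *)
Lemma hdist_aut s a b :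
  s \in hamming_aut m q -> hdist (s a) (s b) = hdist a b.
Proof.
have le_aut t : t \in hamming_aut m q ->
    forall n u v, hdist u v = n -> (hdist (t u) (t v) <= n)%N.
  move=> autt; elim=> [|n IHn] u v duv.
    by move/eqP: duv; rewrite hdist_eq0 => /eqP->; rewrite hdistxx.
  have /card_gt0P[i] : (0 < hdist u v)%N by rewrite duv.
  (* Copying the entry [u i] into [v] gives a neighbour of [v] one step closer to [u]. *)
  rewrite inE => uvi; have := hdist_upd u v i (u i).
  rewrite uvi eqxx duv /= addn1 addn0 => -[/IHn le_n].
  have vw : hadj (upd v i (u i)) v by rewrite hadj_sym hadj_upd.
  by rewrite -(hadj_aut _ _ autt) in vw; apply: leq_trans (hdist_hadj _ vw) _.
move=> auts; apply/eqP; rewrite eqn_leq (le_aut _ auts _ _ _ erefl) /=.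
have := le_aut _ (groupVr auts) _ _ _ (erefl (hdist (s a) (s b))).
by rewrite !permK.
Qed.

Lemma base_perm_aut g : base_perm g \in hamming_aut m q.
Proof.
rewrite inE; apply/forallP => a; apply/forallP => b.
rewrite /hadj !hdistE !permE (eq_bigr (fun i => (a i != b i) : nat)) //.
by move=> i _; rewrite !ffunE (inj_eq perm_inj).
Qed.

Lemma top_perm_aut (s : 'S_m) : top_perm q s \in hamming_aut m q.
Proof.
rewrite inE; apply/forallP => a; apply/forallP => b.
rewrite /hadj !hdistE !permE (reindex_inj (@perm_inj _ s)) /=.
by rewrite (eq_bigr (fun i => (a i != b i) : nat)) // => i _; rewrite !ffunE permK.
Qed.

Lemma im_top_base (y : 'S_q) (s : 'S_m) v :
  im (top_perm q s (base_perm [ffun=> y] v)) = [set y x | x in im v].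
Proof.
rewrite !permE; apply/setP => x.
apply/imsetP/imsetP => [[i _ ->]|[_ /imsetP[i _ ->] ->]].
  by exists (v (s^-1 i)); rewrite ?mem_im // !ffunE.
by exists (s i); rewrite // !ffunE permK.
Qed.

Lemma top_base_cst (y : 'S_q) (s : 'S_m) x :
  top_perm q s (base_perm [ffun=> y] (cst x)) = cst (y x).
Proof. by rewrite !permE; apply/ffunP => i; rewrite !ffunE. Qed.

Lemma hdist_cst x y : x != y -> hdist (cst x) (cst y) = m.
Proof.
move=> xy; rewrite hdistE (eq_bigr (fun=> 1%N)).
  by rewrite sum_nat_const card_ord muln1.
by move=> i _; rewrite !ffunE xy.
Qed.

(** An injective word takes the value [x] at most once. *)
Lemma hdist_cst_inj x v : injective v -> (m.-1 <= hdist (cst x) v)%N.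
Proof.
move=> injv; rewrite hdistE.
have [i /eqP vi|nx] := pickP (fun i => v i == x); last first.
  rewrite (eq_bigr (fun=> 1%N)); first by rewrite sum_nat_const card_ord muln1 leq_pred.
  by move=> i _; rewrite ffunE eq_sym nx.
rewrite -vi (bigD1 i) //= ffunE eqxx add0n.
rewrite (eq_bigr (fun=> 1%N)); last first.
  by move=> k ki; rewrite ffunE (inj_eq injv) eq_sym ki.
by rewrite sum1_card cardC1 card_ord.
Qed.

(** The overwritten value survives at position [j]. *)
Lemma im_upd v i j x : i != j -> v i = v j -> im (upd v i x) = x |: im v.
Proof.
move=> ij vij; apply/setP => y; rewrite in_setU1; apply/imsetP/orP.
  case=> k _ ->; rewrite ffunE; case: (eqVneq k i) => _; first by left.
  by right; apply: mem_im.
case=> [/eqP->|/imsetP[k _ ->]]; first by exists i; rewrite // ffunE eqxx.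
have [->|ki] := eqVneq k i; last by exists k; rewrite // ffunE (negPf ki).
by exists j; rewrite // ffunE eq_sym (negPf ij).
Qed.

Lemma hadj_cst_im x v : hadj (cst x) v -> (#|im v| <= 2)%N.
Proof.
move=> /hadjP[i [y [_ ->]]]; apply: leq_trans (_ : #|[set x; y]| <= 2)%N.
  apply/subset_leq_card/subsetP => _ /imsetP[k _ ->].
  by rewrite !ffunE !inE; case: (k == i); rewrite eqxx ?orbT.
by rewrite cards2; case: (_ != _).
Qed.

Lemma im_le1_cst v (i0 : 'I_m) : (#|im v| <= 1)%N -> v = cst (v i0).
Proof.
move=> le1; apply/ffunP => i; rewrite ffunE.
by apply: (card_le1_eqP le1); apply: mem_im.
Qed.

(* Since the distance from [w] to [upd (cst a) i x] exceeds that to [cst a] by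
   [(w i != x) - (w i != a)], distances detect whether [w i] is [x] or [a]. *)
Lemma aut_fix_cst_top t (a x0 : 'I_q) :
    x0 != a -> t \in hamming_aut m q -> (forall x, t (cst x) = cst x) ->
  t \in top m q.
Proof.
move=> x0a autt fixt.
(* The image is some neighbour of [cst a]; its distance to the fixed word [cst x] forces the new
   entry to be [x] again. *)
have dirP i x : x != a -> exists j, t (upd (cst a) i x) = upd (cst a) j x.
  move=> xa; have /hadjP[j [z [za tE]]] : hadj (cst a) (t (upd (cst a) i x)).
    by rewrite -{1}(fixt a) hadj_aut // hadj_upd // ffunE.
  exists j; rewrite tE; congr upd; apply/esym/eqP.
  have := hdist_upd (cst x) (cst a) i x; have := hdist_upd (cst x) (cst a) j z.
  rewrite -tE -{1}(fixt x) hdist_aut // !ffunE xa eqxx /=.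
  by case: eqP => //= _; lia.
have detect i x j w : x != a -> t (upd (cst a) i x) = upd (cst a) j x ->
    ((t w j == x) = (w i == x)) * ((t w j == a) = (w i == a)).
  move=> xa tE.
  have := hdist_upd (t w) (cst a) j x; have := hdist_upd w (cst a) i x.
  have := hdist_aut w (cst a) autt; have := hdist_aut w (upd (cst a) i x) autt.
  rewrite tE fixt !ffunE => -> ->.
  have [->|wix] := eqVneq (w i) x; have [->|twx] := eqVneq (t w j) x;
    rewrite ?(negPf xa) //=.
  - by case: eqP => //=; lia.
  - by case: eqP => //=; lia.
  - by do 2 case: eqP => //=; lia.
have /fin_all_exists[sf sfE] := fun i => dirP i x0 x0a.
have sfP i w : t w (sf i) = w i.
  have [/eqP wi|wi] := boolP (w i == a).
    by apply/eqP; rewrite wi (detect i x0) // wi.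
  have [j tE] := dirP i _ wi.
  (* The position must not depend on the letter: [detect] for [x0], applied to the word
     [upd (cst a) i (w i)], shows that its image differs from [a] at [sf i], hence [sf i] is [j]. *)
  have -> : sf i = j.
    have := (detect i x0 _ (upd (cst a) i (w i)) x0a (sfE i)).2.
    rewrite tE !ffunE eqxx (negPf wi).
    by case: (sf i =P j) => //; rewrite eqxx.
  by apply/eqP; rewrite (detect i (w i)).
have injsf : injective sf.
  move=> i k ik; apply/eqP/negPn/negP => ki.
  have := sfP i (upd (cst a) i x0); rewrite ik sfP !ffunE eqxx.
  by rewrite eq_sym (negPf ki) => /eqP; rewrite eq_sym (negPf x0a).
apply/imsetP; exists (perm injsf) => //; apply/permP => w; apply/ffunP => k.
rewrite permE ffunE -[in LHS](permKV (perm injsf) k) [in LHS]permE.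
exact: sfP.
Qed.

Lemma min_dist_exists (C : {set hvertex m q}) a b :
  a \in C -> b \in C -> a != b -> exists delta, min_dist C delta.
Proof.
move=> aC bC ab.
pose P n := [exists u in C, [exists v in C, (u != v) && (hdist u v == n)]].
have exP : exists n, P n.
  exists (hdist a b); apply/exists_inP; exists a => //.
  by apply/exists_inP; exists b; rewrite // ab eqxx.
exists (ex_minn exP); case: ex_minnP => n Pn minn; split=> [|u v uC vC uv].
  have /exists_inP[u uC /exists_inP[v vC /andP[uv /eqP]]] := Pn.
  by exists u, v.
apply: minn; apply/exists_inP; exists u => //.
by apply/exists_inP; exists v; rewrite // uv /=.
Qed.

End HammingGraph.

(** * The code in [H(q,q)], its neighbours and their stabiliser *)

Section Stabiliser.

Variable q : nat.
Implicit Types (v w : hvertex q q) (g : 'S_q).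

Lemma perm_vertex_fun_inj g : injective (perm_vertex g).
Proof. by move=> i j; rewrite !ffunE => /perm_inj. Qed.

Lemma perm_vertex_inj : injective (@perm_vertex q).
Proof.
by move=> g h /ffunP gh; apply/permP => i; have := gh i; rewrite !ffunE.
Qed.

Lemma perm_vertexP v : injective v -> exists g, v = perm_vertex g.
Proof. by move=> injv; exists (perm injv); apply/ffunP => i; rewrite ffunE permE. Qed.

Lemma im_full_inj v : #|im v| = q -> injective v.
Proof.
move=> imv; have : #|im v| == #|'I_q| by rewrite imv card_ord.
by move=> /imset_injP injv i j; apply: injv.
Qed.

Lemma not_inj_repeat v : ~ injective v -> exists i j, i != j /\ v i = v j.
Proof.
move=> /injectiveP/injectivePn[i [j ij vij]]; by exists i, j.
Qed.

(** The value [g i] is lost at the changed position, and the new entry already occurs elsewhere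
    since [g] is onto. *)
Lemma im_hadj_perm g v : hadj (perm_vertex g) v -> #|im v| = q.-1.
Proof.
move=> /hadjP[i [x [xi ->]]]; rewrite ffunE in xi.
suff -> : im (upd (perm_vertex g) i x) = [set~ g i] by rewrite cardsC1 card_ord.
apply/setP => y; rewrite !inE; apply/imsetP/idP => [[k _ ->]|yi].
  by rewrite !ffunE; case: (eqVneq k i) => // ki; rewrite (inj_eq perm_inj).
exists (g^-1 y) => //; rewrite !ffunE permKV; case: eqVneq => // E.
by rewrite -E permKV eqxx in yi.
Qed.

Hypothesis hq : (4 <= q)%N.

Let C : {set hvertex q q} := perm_code 'Alt_('I_q) :|: rep_code q q.

Lemma perm_vertex_notin_rep g x : perm_vertex g != cst q x.
Proof.
have q0 : (0 < q)%N by lia.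
have q1 : (1 < q)%N by lia.
apply/eqP => E; have := @perm_vertex_fun_inj g (Ordinal q0) (Ordinal q1).
by rewrite E !ffunE => /(_ erefl)/(congr1 val).
Qed.

Lemma perm_vertex_inC g : (perm_vertex g \in C) = ~~ odd_perm g.
Proof.
rewrite in_setU (mem_imset _ _ perm_vertex_inj) Alt_even.
have [/imsetP[x _ /eqP E]|_] := boolP (_ \in rep_code q q).
  by rewrite (negPf (perm_vertex_notin_rep g x)) in E.
by rewrite orbF.
Qed.

Lemma cst_inC x : cst q x \in C.
Proof. by rewrite in_setU orbC imset_f. Qed.

Lemma inCP v : v \in C ->
  (exists2 g, ~~ odd_perm g & v = perm_vertex g) \/ (exists x, v = cst q x).
Proof.
move=> vC; move: (vC); rewrite {1}in_setU => /orP[/imsetP[g _ E]|/imsetP[x _ ->]].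
  by left; exists g; rewrite // -perm_vertex_inC -E.
by right; exists x.
Qed.

Lemma hadj_cst_notin x v : hadj (cst q x) v -> v \notin C.
Proof.
rewrite /hadj => /eqP d1; apply/negP => /inCP[[g _ E]|[y E]].
  have := @hdist_cst_inj _ _ x _ (@perm_vertex_fun_inj g).
  by rewrite -E d1; lia.
have [xy|xy] := eqVneq x y; first by rewrite E xy hdistxx in d1.
by rewrite E hdist_cst // in d1; lia.
Qed.

Lemma im_perm g : #|@im q q (perm_vertex g)| = q.
Proof. by rewrite card_imset ?card_ord //; apply: perm_vertex_fun_inj. Qed.

Lemma im_cst x : (#|@im q q (cst q x)| <= 1)%N.
Proof.
apply/card_le1_eqP => _ _ /imsetP[i _ ->] /imsetP[j _ ->].
by rewrite !ffunE.
Qed.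

Lemma fresh_value v : (#|im v| < q)%N -> exists x, x \notin im v.
Proof.
move=> lt; have /card_gt0P[x] : (0 < #|~: im v|)%N.
  by have := cardsC (im v); rewrite card_ord; lia.
by rewrite inE; exists x.
Qed.

(** This description does not mention parity, which is why odd permutations of letters or positions
    also preserve the neighbour set. *)
Lemma code_nbrsP v :
  reflect (#|im v| = q.-1 \/ exists x, hadj (cst q x) v) (v \in code_nbrs C).
Proof.
rewrite inE; apply: (iffP andP) => [[_ /exists_inP[a /inCP[[g _ ->]|[x ->]] av]]|].
- by left; apply: im_hadj_perm av.
- by right; exists x.
case=> [imv|[x xv]]; last first.
  split; first exact: hadj_cst_notin xv.
  by apply/exists_inP; exists (cst q x); rewrite ?cst_inC.
split.
  apply/negP => /inCP[[g _ E]|[x E]].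
    by have := im_perm g; rewrite -E imv; lia.
  by have := im_cst x; rewrite -E imv; lia.
have [|i [j [ij vij]]] := @not_inj_repeat v.
  by move=> /perm_vertexP[g E]; have := im_perm g; rewrite -E imv; lia.
have [|x xv] := @fresh_value v; first by rewrite imv; lia.
have [|g gE] := @perm_vertexP (upd v i x).
  by apply: im_full_inj; rewrite (im_upd _ ij vij) cardsU1 xv imv; lia.
have xvi k : x != v k by apply: contra xv => /eqP->; apply: mem_im.
(* Putting the missing value [x] at [i] or at [j] gives two permutations that differ by [tperm i j],
   so one of them is even. *)
apply/exists_inP; have [og|eg] := boolP (odd_perm g); last first.
  by exists (perm_vertex g); rewrite ?perm_vertex_inC // -gE hadj_sym hadj_upd.
exists (perm_vertex (tperm i j * g)).
  by rewrite perm_vertex_inC odd_permM odd_tperm ij og.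
suff -> : perm_vertex (tperm i j * g) = upd v j x by rewrite hadj_sym hadj_upd.
have gk k : g k = upd v i x k by rewrite gE ffunE.
apply/ffunP => k; rewrite !ffunE permM gk ffunE.
case: tpermP => [->|->|/eqP ki /eqP kj].
- by rewrite eq_sym (negPf ij).
- by rewrite !eqxx.
- by rewrite (negPf ki) (negPf kj).
Qed.

(** Stated through adjacency and the neighbour set alone, so that the stabiliser preserves it. *)
Definition nbrs_full v := forall w, hadj v w -> w \in code_nbrs C.

Lemma nbrs_full_cst x : nbrs_full (cst q x).
Proof. by move=> w xw; apply/code_nbrsP; right; exists x. Qed.

Lemma nbrs_full_perm g : nbrs_full (perm_vertex g).
Proof. by move=> w /im_hadj_perm gw; apply/code_nbrsP; left. Qed.

(** Otherwise [v] has a repeated entry and [k] distinct ones, with [2 <= k < q]. Overwriting the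
    repeat by a fresh or an old value gives [k + 1] or [k] distinct entries, and each count must be
    [q - 1] or at most 2. This forces [k = q - 2 <= 2], contradicting [5 <= q]. *)
Lemma nbrs_fullP v : (5 <= q)%N -> nbrs_full v ->
  (exists x, v = cst q x) \/ (exists g, v = perm_vertex g).
Proof.
move=> q5 fullv; have q0 : (0 < q)%N by lia.
have [le1|gt1] := leqP #|im v| 1.
  by left; exists (v (Ordinal q0)); apply: im_le1_cst.
have [/injectiveP/perm_vertexP|/injectiveP] := boolP (injectiveb v); first by right.
move=> ninj; have [i [j [ij vij]]] := not_inj_repeat ninj.
have imvq : (#|im v| < q)%N.
  rewrite ltn_neqAle; apply/andP; split; last first.
    by apply: leq_trans (max_card _) _; rewrite card_ord.
  by apply/eqP => /im_full_inj.
have [x xv] := fresh_value imvq.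
have [y yv yi] : exists2 y, y \in im v & y != v i.
  have /card_gt0P[y] : (0 < #|im v :\ v i|)%N.
    by rewrite (cardsD1 (v i)) mem_im in gt1.
  by rewrite !inE => /andP[]; exists y.
have size_upd z : z != v i -> #|im (upd v i z)| = q.-1 \/ (#|im (upd v i z)| <= 2)%N.
  move=> /hadj_upd/fullv/code_nbrsP[|[c /hadj_cst_im]]; by [left | right].
have := size_upd _ yi.
have xi : x != v i by apply: contra xv => /eqP->; apply: mem_im.
have := size_upd _ xi.
rewrite !(im_upd _ ij vij) !cardsU1 xv yv /=; move: gt1 imvq.
by move: #|_| => k; lia.
Qed.

Lemma nbrs_full_aut s v :
    s \in 'N_(hamming_aut q q)(code_nbrs C | 'P) -> nbrs_full v ->
  nbrs_full (s v).
Proof.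
move=> /setIP[auts /astabsP stabs] fullv w.
rewrite -[w](permKV s) hadj_aut // => /fullv.
by rewrite -stabs.
Qed.

Lemma stab_cst s x :
    (5 <= q)%N -> s \in 'N_(hamming_aut q q)(code_nbrs C | 'P) ->
  exists y, s (cst q x) = cst q y.
Proof.
move=> q5 Ns; have autC : s \in hamming_aut q q by case/setIP: Ns.
have [//|[g gE]] := nbrs_fullP q5 (nbrs_full_aut Ns (@nbrs_full_cst x)).
have q0 : (0 < q)%N by lia.
have q1 : (1 < q)%N by lia.
pose i := Ordinal q0; pose j := Ordinal q1.
have ij : i != j by [].
(* If the image were a permutation, [u] would be a full word at distance 2 from it; pulled back by
   [s], it would lie at distance 2 from [cst q x]. *)
pose u := perm_vertex (tperm i j * g).
have du : hdist (s (cst q x)) u = 2%N.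
  rewrite gE /hdist; suff -> : [set k | perm_vertex g k != u k] = [set i; j].
    by rewrite cards2 ij.
  apply/setP => k; rewrite !inE !ffunE permM (inj_eq perm_inj).
  case: tpermP => [->|->|/eqP/negPf-> /eqP/negPf->]; last by rewrite eqxx.
    by rewrite eqxx.
  by rewrite eqxx orbT eq_sym.
have := nbrs_full_aut (groupVr Ns) (@nbrs_full_perm (tperm i j * g)).
rewrite -/u -{1}(permKV s u) hdist_aut // in du *.
case/(nbrs_fullP q5) => [[y E]|[h E]]; rewrite E in du.
  have [xy|xy] := eqVneq x y; first by rewrite xy hdistxx in du.
  by rewrite hdist_cst // in du; lia.
by have := @hdist_cst_inj _ _ x _ (@perm_vertex_fun_inj h); rewrite du; lia.
Qed.

Lemma stab_sub s :
    (5 <= q)%N -> s \in 'N_(hamming_aut q q)(code_nbrs C | 'P) ->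
  s \in top q q * diag q q.
Proof.
move=> q5 Ns; have [auts _] := setIP Ns.
have /fin_all_exists[y yE] := fun x => stab_cst x q5 Ns.
have q0 : (0 < q)%N by lia.
have q1 : (1 < q)%N by lia.
have injy : injective y.
  move=> a b ab; have : s (cst q a) = s (cst q b) by rewrite !yE ab.
  by move=> /perm_inj/ffunP/(_ (Ordinal q0)); rewrite !ffunE.
(* The diagonal element that agrees with [s] on constant words, so that [s * d^-1] fixes each of
   them. *)
pose d := base_perm [ffun=> perm injy] : {perm hvertex q q}.
have dE x : d (cst q x) = cst q (y x).
  by rewrite permE; apply/ffunP => i; rewrite !ffunE permE.
rewrite -(mulgKV d s); apply: mem_mulg; last exact: imset_f.
have x0a : Ordinal q1 != Ordinal q0 by [].
apply: (aut_fix_cst_top x0a) => [|x]; last by rewrite permM yE -dE permK.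
by rewrite groupM ?groupV ?base_perm_aut.
Qed.

End Stabiliser.

(** * Elusiveness, intransitivity and the full stabiliser *)

Theorem proposition3p10 (q : nat) (X : {group {perm hvertex q q}})
    (C : {set hvertex q q})
    (hq : (4 <= q)%N)
    (defC : C = perm_code 'Alt_('I_q) :|: rep_code q q)
    (defX : diag q q ><| top q q = X) :
  [/\ exists delta : nat, elusive_pair delta C X,
      ~~ [transitive X, on code_nbrs C | 'P]
    & (5 <= q)%N -> X = 'N_(hamming_aut q q)(code_nbrs C | 'P) :> {set {perm hvertex q q}}].
Proof.
have q0 : (0 < q)%N by lia.
have q1 : (1 < q)%N by lia.
pose o0 := Ordinal q0; pose o1 := Ordinal q1.
have o01 : o0 != o1 by [].
have XE : diag q q * top q q = X := sdprodW defX.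
have XP s : s \in X -> exists y t, s = base_perm [ffun=> y] * top_perm q t.
  by rewrite -XE => /mulsgP[_ _ /imsetP[y _ ->] /imsetP[t _ ->] ->]; exists y, t.
have topX : top q q \subset X by rewrite -XE mulG_subr.
have diagX : diag q q \subset X by rewrite -XE mulG_subl.
have autX : X \subset hamming_aut q q.
  by apply/subsetP => s /XP[y [t ->]]; rewrite groupM ?base_perm_aut ?top_perm_aut.
have imX s v : s \in X -> #|im (s v)| = #|im v|.
  by move=> /XP[y [t ->]]; rewrite permM im_top_base card_imset //; apply: perm_inj.
have actsX : [acts X, on code_nbrs C | 'P].
  apply/subsetP => s sX; apply/astabsP => v.
  have stab u t : t \in X -> u \in code_nbrs C -> t u \in code_nbrs C.
    rewrite defC => tX /(code_nbrsP hq)[iu|[x xu]]; apply/(code_nbrsP hq).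
      by left; rewrite imX.
    right; have [y [z tE]] := XP _ tX; exists (y x).
    by rewrite -(top_base_cst y z) -permM -tE hadj_aut // (subsetP autX).
  apply/idP/idP => [|/stab->//].
  by move=> /(stab _ _ (groupVr sX)); rewrite permK.
have p1C : perm_vertex 1 \in C by rewrite defC perm_vertex_inC // odd_perm1.
split.
- have c0C : cst q o0 \in C by rewrite defC cst_inC.
  have [delta dC] := min_dist_exists p1C c0C (perm_vertex_notin_rep hq _ _).
  (* Swapping two positions sends the identity word to an odd permutation, which is outside [C]. *)
  exists delta; split=> //; apply/negP => /acts_act/(_ (top_perm q (tperm o0 o1))).
  move=> /(_ (subsetP topX _ (imset_f _ isT)) (perm_vertex 1)).
  rewrite p1C /= /aperm.
  suff -> : top_perm q (tperm o0 o1) (perm_vertex 1) = perm_vertex (tperm o0 o1).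
    by rewrite defC perm_vertex_inC // odd_tperm o01.
  by rewrite permE; apply/ffunP => k; rewrite !ffunE perm1 tpermV.
- apply/negP => trX.
  (* One neighbour from each family: [u] has [q - 1 >= 3] distinct entries and [v] at most 2, while
     [X] preserves this number. *)
  pose u := upd (perm_vertex 1) o0 o1; pose v := upd (cst q o0) o0 o1.
  have pu : hadj (perm_vertex 1) u by rewrite hadj_upd // ffunE perm1 eq_sym.
  have cv : hadj (cst q o0) v by rewrite hadj_upd // ffunE eq_sym.
  have uN : u \in code_nbrs C.
    by rewrite defC; apply/(code_nbrsP hq); left; apply: im_hadj_perm pu.
  have vN : v \in code_nbrs C.
    by rewrite defC; apply/(code_nbrsP hq); right; exists o0.
  have [s sX vE] := atransP2 trX uN vN.
  have := hadj_cst_im cv; rewrite vE /= /aperm imX // (im_hadj_perm pu).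
  by lia.
- move=> q5; apply/eqP; rewrite eqEsubset subsetI autX actsX /=.
  apply/subsetP => s; rewrite defC => /(stab_sub hq q5)/mulsgP[t d tT dD ->].
  by rewrite groupM ?(subsetP topX t) ?(subsetP diagX d).
Qed.
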